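(* Let $G$ be a countable group and let $V$ be a finite-dimensional vector space over a field $\mathbb{K}$. Let $\tau \colon X \to V^G$ be a linear cellular automaton, where $X \subset V^G$ is a linear subshift. Then $\tau(X)$ is closed in $V^G$ for the prodiscrete topology and is therefore a linear subshift of $V^G$.
   Context: $V^G$ is the set of all maps (configurations) $x \colon G \to V$, with its product $\mathbb{K}$-vector space structure, the prodiscrete topology (product of the discrete topologies on the factors $V$), and the left $G$-action $(gx)(h) = x(g^{-1}h)$. A linear subshift is a closed $G$-invariant vector subspace of $V^G$. A linear cellular automaton $\tau \colon X \to Y$ between linear subshifts $X,Y \subset V^G$ is a $\mathbb{K}$-linear map for which there exist a finite subset $M \subset G$ (a memory set) and a map $\mu \colon V^M \to V$ with $\tau(x)(g) = \mu((g^{-1}x)\vert_M)$ for all $x \in X$ and $g \in G$, where $\vert_M$ denotes restriction to $M$. *)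

(* Defs.v *)
From mathcomp Require Import all_boot all_algebra.
From mathcomp Require Import all_classical topology.
Set Implicit Arguments.
Unset Strict Implicit.
Unset Printing Implicit Defensive.
Import GRing.Theory.
Local Open Scope classical_set_scope.
Local Open Scope ring_scope.

Definition prodiscrete (G : Type) (V : choiceType) : topologicalType :=
  prod_topology (fun _ : G => discrete_topology V).

Definition shift (G : groupType) (V : Type) (g : G) (x : G -> V) : G -> V :=
  fun h => x (g^-1 * h)%g.

Section LinearSubshifts.
Variables (G : groupType) (K : fieldType) (V : vectType K).

Definition shift_invariant (X : set (G -> V)) : Prop :=
  forall (g : G) (x : G -> V), X x -> X (shift g x).

Definition linear_subshift (X : set (G -> V)) : Prop :=
  [/\ closed (X : set (prodiscrete G V)),
      shift_invariant X
    & GRing.submod_closed (mem X)].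

(* A map defined on a set of configurations is represented by a total
   function whose values outside that set are irrelevant: every clause below
   only constrains [tau] on [X].  The local rule [mu] is an arbitrary map on
   V^M, the functions on the subtype of [G] carried by [M], and [sigL M] is
   the restriction of configurations to [M]. *)
Definition linear_cellular_automaton (X Y : set (G -> V))
    (tau : (G -> V) -> (G -> V)) : Prop :=
  [/\ set_fun X Y tau,
      (forall (a : K) (x y : G -> V), X x -> X y ->
         tau (a *: x + y) = a *: tau x + tau y)
    & exists (M : set G) (mu : (M -> V) -> V), finite_set M /\
        forall (x : G -> V) (g : G), X x ->
          tau x g = mu (sigL M (shift g^-1%g x))].

End LinearSubshifts.

(* Main.v *)
Require Import Defs.
From mathcomp Require Import all_boot all_algebra.
From mathcomp Require Import all_classical topology.
Import GRing.Theory.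
Local Open Scope classical_set_scope.

(** Let [y] be in the closure of [tau @` X], and number the elements of [G].
    For each [n], the set [L n] of the [x] in [X] such that [tau x] and [y]
    agree at the first [n] elements of [G] is nonempty, because [y] is in the
    closure, and affine, because [X] and [tau] are linear.  The sets [L n]
    decrease, and a point in all of them would be a preimage of [y].  They may
    be infinite-dimensional and [V] may be infinite, so neither dimension nor
    compactness produces such a point directly.

    What does work is linear compactness, one coordinate at a time.  The values
    at one element [g] of the members of [L n] form a nonempty affine subset of
    the finite-dimensional space [V], decreasing with [n]; such a sequence is
    stationary, so some [v] is attained in every [L n]
    ([affine_nonincreasing_bigcap]).  Replacing each [L n] by its members with
    value [v] at [g] gives again a decreasing sequence of nonempty affine sets,
    and one goes on with the next element of [G].  The chosen values make up a
    configuration [x] which on every finite set of coordinates coincides with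
    some member of every [L n] ([affine_nonincreasing_approx]).

    Since [X] is closed, [x] is in [X]; since [tau x g] depends only on the
    finitely many values of [x] on [g * M], it is equal to [tau z g] for some
    [z] in an [L n] with [n] beyond the number of [g], that is, to [y g]. *)

Set Implicit Arguments.
Unset Strict Implicit.
Local Open Scope ring_scope.

(** * Decreasing sequences of affine sets *)

Section AffineSets.
Variables (K : fieldType).

(** The translates of linear subspaces, and the empty set. *)
Definition affine (U : lmodType K) (A : set U) : Prop :=
  forall (a : K) (x y z : U), A x -> A y -> A z -> A (a *: (x - y) + z).

(** A subspace of maximal dimension among those contained in [D] is all of [D],
    as adding one more vector of [D] to it cannot raise its dimension.  This
    gives access to the dimension of a linear set known only by a predicate. *)
Lemma submodule_vspace (V : vectType K) (D : set V) :
  D 0 -> (forall (a : K) (u v : V), D u -> D v -> D (a *: u + v)) ->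
  exists W : {vspace V}, forall v, (v \in W) <-> D v.
Proof.
move=> D0 Dlin.
pose P d := `[< exists2 W : {vspace V}, \dim W = d & forall v, v \in W -> D v >].
have P0 : exists d, P d.
  exists 0%N; apply/asboolP; exists 0%VS; first exact: dimv0.
  by move=> v; rewrite memv0 => /eqP ->.
have Pdim d : P d -> (d <= \dim {:V})%N.
  by move=> /asboolP[W <- _]; exact/dimvS/subvf.
have [d /asboolP[W dimW WD] dmax] := ex_maxnP P0 Pdim.
exists W => v; split=> [/WD //|Dv].
have WvD u : u \in (W + <[v]>)%VS -> D u.
  move=> /memv_addP[w Ww [_ /vlineP[a ->] ->]].
  by rewrite addrC; apply: Dlin => //; exact: WD.
have /dmax : P (\dim (W + <[v]>)) by apply/asboolP; exists (W + <[v]>)%VS.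
rewrite -dimW => ledim.
have /eqP -> : W == (W + <[v]>)%VS by rewrite eqEdim addvSl.
by apply: (subvP (addvSr _ _)); exact: memv_line.
Qed.

(** The spaces of differences [W n] decrease, so they are all equal once their
    dimension is minimal, at [N] say.  From then on the [A n] have the same
    direction and are nested, so they are equal, and any point of [A N] will
    do. *)
Lemma affine_nonincreasing_bigcap (V : vectType K) (A : nat -> set V) :
  (forall n, affine (A n)) -> (forall n, A n !=set0) ->
  (forall m n, (m <= n)%N -> A n `<=` A m) ->
  exists v, forall n, A n v.
Proof.
move=> Aaff A0 Adecr.
pose D n : set V := [set v | exists x y, [/\ A n x, A n y & v = x - y]].
have /choice[W WD] n : exists W : {vspace V}, forall v, (v \in W) <-> D n v.
  apply: submodule_vspace.
    by have [x Ax] := A0 n; exists x, x; rewrite subrr.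
  move=> a _ _ [x [y [Ax Ay ->]]] [z [t [Az At ->]]].
  by exists (a *: (x - y) + z), t; split => //; [exact: Aaff|rewrite addrA].
have Wdecr m n : (m <= n)%N -> (W n <= W m)%VS.
  move=> mn; apply/subvP => v /WD[x [y [Ax Ay vE]]].
  by apply/WD; exists x, y; split => //; exact: (Adecr m n).
have exdim : exists d, `[< exists n, \dim (W n) = d >].
  by exists (\dim (W 0%N)); apply/asboolP; exists 0%N.
have [d /asboolP[N dimN] dmin] := ex_minnP exdim.
have Wstab n : (N <= n)%N -> W n = W N.
  move=> Nn; apply/eqP; rewrite eqEdim Wdecr //= dimN; apply: dmin.
  by apply/asboolP; exists n.
have [z Az] := A0 N; exists z => n.
have [nN|/ltnW Nn] := leqP n N; first exact: (Adecr n N).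
have [p Ap] := A0 n.
have : z - p \in W n.
  by rewrite Wstab //; apply/WD; exists z, p; split => //; exact: (Adecr N n).
move=> /WD[x [y [Ax Ay zpE]]].
by rewrite -[z](subrK p) zpE -[x - y]scale1r; exact: Aaff.
Qed.

(** The function [x] need not be in any [L n], nor need the [L n] have a common
    point: nothing is assumed to be closed.  The numbering of [I] is the
    injection [f], with [e] taking arbitrary values at the numbers that [f] does
    not use; the construction below may then fix the same coordinate several
    times, and what counts is the value chosen at the stage [f i]. *)
Lemma affine_nonincreasing_approx (I : Type) (V : vectType K)
    (f : I -> nat) (e : nat -> I) (L : nat -> set (I -> V)) :
  cancel f e ->
  (forall n, affine (L n)) -> (forall n, L n !=set0) ->
  (forall m n, (m <= n)%N -> L n `<=` L m) ->
  exists x : I -> V, forall n k,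
    exists2 z, L n z & forall i, (f i < k)%N -> z i = x i.
Proof.
move=> fK Laff L0 Ldecr.
pose good (S : nat -> set (I -> V)) := [/\ forall n, affine (S n),
  forall n, S n !=set0 & forall m n, (m <= n)%N -> S n `<=` S m].
pose val i (S : nat -> set (I -> V)) : V :=
  xget 0 [set v | forall n, exists2 z, S n z & z i = v].
pose fix_at i (S : nat -> set (I -> V)) (n : nat) : set (I -> V) :=
  [set z | S n z /\ z i = val i S].
have good_fix_at i S : good S -> good (fix_at i S).
  move=> [Saff S0 Sdecr].
  (* This is where linear compactness enters: some value is attained at [i]
     in every [S n], so [xget] picks such a value and not its default. *)
  have valP n : exists2 z, S n z & z i = val i S.
    move: n; rewrite /val; case: xgetP => [//|noval]; exfalso.
    have [v vP] : exists v, forall n, [set z i | z in S n] v.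
      apply: affine_nonincreasing_bigcap.
      - move=> n a _ _ _ [x Sx <-] [y Sy <-] [z Sz <-].
        by exists (a *: (x - y) + z) => //; exact: Saff.
      - by move=> n; have [z Sz] := S0 n; exists (z i), z.
      - by move=> m n mn _ [z Sz <-]; exists z => //; exact: Sdecr Sz.
    exact: (noval v vP).
  split.
  - move=> n a x y z [Sx xi] [Sy yi] [Sz zi]; split; first exact: Saff.
    by rewrite /= !fctE xi yi zi subrr scaler0 add0r.
  - by move=> n; have [z Sz zi] := valP n; exists z.
  - by move=> m n mn z [Sz zi]; split => //; exact: Sdecr Sz.
pose S := fix S k := if k is j.+1 then fix_at (e j) (S j) else L.
have goodS k : good (S k) by elim: k => [//|k IHk]; exact: good_fix_at.
exists (fun i => val i (S (f i))) => n k.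
have [_ /(_ n)[z Sz] _] := goodS k.
have Sz_le j : (j <= k)%N -> S j n z.
  move=> /subnK kE; move: Sz; rewrite -kE; elim: (k - j)%N => [//|d IHd].
  by move=> [/IHd].
exists z => [|i fik]; first exact: (Sz_le 0%N).
by have [_] := Sz_le _ fik; rewrite fK.
Qed.

End AffineSets.

(** * Closed images of linear subshifts *)

(** The cylinders around [y] over finite sets of coordinates form a basis of
    neighbourhoods of [y]. *)
Lemma closure_prodiscreteE (G : eqType) (V : choiceType)
    (A : set (prodiscrete G V)) (y : prodiscrete G V) :
  closure A y <-> forall F : set G, finite_set F ->
    exists2 x, A x & forall g, F g -> x g = y g.
Proof.
pose cyl (F : set G) : set (prodiscrete G V) :=
  [set x | forall g, F g -> x g = y g].
split=> [Ay F /finite_seqP[s ->]|Ay B yB].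
  have ycyl : nbhs y (cyl [set` s]).
    elim: s => [|g s IHs]; first by apply: filterS filterT => x _ g.
    have yg : nbhs y [set x : prodiscrete G V | x g = y g].
      exact: (@proj_continuous G (fun=> discrete_topology V) g y _
               (discrete_set1 (y g))).
    apply: filterS (filterI yg IHs) => x [xg xs] h /=.
    by rewrite in_cons => /orP[/eqP ->|]; [exact: xg|exact: xs].
  by have [x [Ax xs]] := Ay _ ycyl; exists x.
have cyl_filter : Filter (filter_from finite_set cyl).
  apply: filter_from_filter; first by exists set0.
  move=> E F finE finF; exists (E `|` F); first by rewrite finite_setU.
  by move=> x xEF; split=> g gEF; apply: xEF; [left|right].
have cyl_cvg : filter_from finite_set cyl --> y.
  apply/cvg_sup => g; apply/cvg_image.
    by rewrite eqEsubset; split => // v _; exists (fun=> v).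
  move=> U /principal_filterP Uy; exists ((fun x => x g) @^-1` U).
    by exists [set g] => // x xg; rewrite /= xg.
  by rewrite image_preimage // eqEsubset; split => // v _; exists (fun=> v).
have [F finF FB] := cyl_cvg B yB.
by have [x Ax xF] := Ay F finF; exists x; split => //; exact: FB.
Qed.

Lemma finite_set_bounded (T : Type) (f : T -> nat) (F : set T) :
  finite_set F -> exists k, forall t, F t -> (f t < k)%N.
Proof.
move=> /(finite_image f)/finite_seqP[s fFs].
exists (\max_(i <- s) i).+1 => t Ft; rewrite ltnS.
have fts : f t \in s by have : (f @` F) (f t) by [exists t]; rewrite fFs.
exact: leq_bigmax_seq.
Qed.

Lemma linear_cellular_image_closed (G : groupType) (K : fieldType)
    (V : vectType K) (X : set (G -> V)) (tau : (G -> V) -> (G -> V)) :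
  countable [set: G] -> linear_subshift X ->
  linear_cellular_automaton X [set: G -> V] tau ->
  closed (tau @` X : set (prodiscrete G V)).
Proof.
move=> /countable_injP[f finj] [Xcl _ [X0 Xlin]] [_ taulin [M [mu [finM tauE]]]].
have {}X0 : X 0 by rewrite inE in X0.
have {}Xlin (a : K) x y : X x -> X y -> X (a *: x + y).
  by move=> Xx Xy; have := Xlin a x y; rewrite !inE; apply.
pose e n : G := xget 1%g [set g | f g = n].
have fK : cancel f e.
  move=> g; apply: finj; rewrite ?inE //.
  by apply: (@xgetPex _ _ [set h | f h = f g]); exists g.
have fin_le n : finite_set [set g | (f g < n)%N].
  apply: (sub_finite_set _ (finite_image e (finite_II n))).
  by move=> g gn; exists (f g).
move=> y /closure_prodiscreteE yclos.
pose L n := [set x | X x /\ forall g, (f g < n)%N -> tau x g = y g].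
have Laff n : affine (L n).
  move=> a u v w [Xu uy] [Xv vy] [Xw wy].
  (* The hypotheses on [tau] and [X] only mention combinations [a *: x + y]. *)
  have uvE : u - v = (-1) *: v + u by rewrite scaleN1r addrC.
  have Xuv : X (u - v) by rewrite uvE; exact: Xlin.
  split=> [|g gn]; first exact: Xlin.
  rewrite taulin // uvE taulin // !fctE uy // vy // wy //.
  by rewrite scaleN1r addNr scaler0 add0r.
have L0 n : L n !=set0.
  by have [_ [x Xx <-] xy] := yclos _ (fin_le n); exists x; split.
have Ldecr m n : (m <= n)%N -> L n `<=` L m.
  by move=> mn x [Xx xy]; split => // g gm; apply: xy; exact: leq_trans mn.
have [x xL] := affine_nonincreasing_approx fK Laff L0 Ldecr.
have Xx : X x.
  apply: Xcl; apply/closure_prodiscreteE => F /(finite_set_bounded f)[k Fk].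
  by have [z [Xz _] zx] := xL 0%N k; exists z => // g /Fk /zx.
exists x => //; apply/funext => g.
have [k Mk] := finite_set_bounded f (finite_image (fun m => g * m)%g finM).
(* [k] makes [z] agree with [x] on [g * M], and [(f g).+1] makes [tau z]
   agree with [y] at [g]. *)
have [z [Xz zy] zx] := xL (f g).+1 k.
rewrite -(zy g) // !tauE //; congr (mu _); apply/eq_sigLP => m /set_mem Mm.
by rewrite /shift invgK zx //; apply: Mk; exists m.
Qed.

Unset Implicit Arguments.

Theorem theorem4p2 (G : groupType) (K : fieldType) (V : vectType K)
    (countableG : countable [set: G])
    (X : set (G -> V)) (tau : (G -> V) -> (G -> V))
    (subshiftX : linear_subshift X)
    (ca_tau : linear_cellular_automaton X [set: G -> V] tau) :
  closed (tau @` X : set (prodiscrete G V)) /\ linear_subshift (tau @` X).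
Proof.
have tauX_closed :=
  linear_cellular_image_closed countableG subshiftX ca_tau.
split=> //; split=> //.
  have [_ Xinv _] := subshiftX; have [_ _ [M [mu [_ tauE]]]] := ca_tau.
  move=> g _ [x Xx <-]; exists (shift g x); first exact: Xinv.
  apply/funext => h; rewrite {2}/shift !tauE //; last exact: Xinv.
  congr (mu (sigL M _)); apply/funext => k.
  by rewrite /shift !invgK mulgA.
have [_ _ [X0 Xlin]] := subshiftX; have [_ taulin _] := ca_tau.
have {}X0 : X 0 by rewrite inE in X0.
split.
  rewrite inE; exists 0 => //.
  (* Taking the coefficient [0] would only give [tau 0 = tau 0]. *)
  by have := taulin (-1) 0 0 X0 X0; rewrite scaler0 addr0 scaleN1r addNr.
move=> a _ _ /set_mem[u Xu <-] /set_mem[v Xv <-].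
rewrite inE; exists (a *: u + v); last exact: taulin.
by have := Xlin a u v; rewrite !inE; apply.
Qed.
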